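(* Let $G = C(n,S)$ be a circulant graph that is bipartite (so $n = 2k$ is even). Place the vertices of $G$ on a circle in a YSL-order and draw every edge as a straight chord. Then there is a proper edge-coloring of $G$ with $\Delta(G)$ colors such that no two edges of the same color cross. That is, $G$ is dispersable with respect to the YSL-order.
   Context: Circulants. For $n \ge 3$ and $S \subseteq \{1,2,\ldots,\lfloor n/2\rfloor\}$, the circulant $C(n,S)$ is the graph with vertex set $\{1,\ldots,n\}$. Its edge set is $\{ij : j \equiv i+s \pmod n \text{ for some } s \in S\}$. The elements of $S$ are called jump-lengths. $\Delta(G)$ denotes the maximum degree of $G$. YSL-order. Let $n = 2k$. Label the positions on a circle, in clockwise order, as $p_1, p_2, \ldots, p_{2k}$. A YSL-order places the odd vertices at the odd positions in their natural clockwise order, namely vertex $2i-1$ at position $p_{2i-1}$. It places the even vertices at the even positions so that, read clockwise, they appear in counterclockwise (decreasing cyclic) order. In other words, there is a fixed integer $m$ such that position $p_{2i}$ carries the even vertex congruent to $2m-2i \pmod{2k}$, for $i = 1,\ldots,k$. The value of $m$, that is, where vertex $2$ is placed, is arbitrary. For example, one YSL-order reads clockwise $\ldots, 2k-3, 4, 2k-1, 2, 1, 2k, 3, 2k-2, 5, \ldots$. Crossing and dispersability. Two chords cross if their four endpoints are distinct and interleave around the circle. A graph drawn with vertices on a circle and edges as chords is dispersable with respect to that vertex order if its edges can be colored with $\Delta(G)$ colors so that two edges of the same color neither share an endpoint nor cross. Equivalently, each color class (page) is a non-crossing matching.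
   Formalization: The formal theorem adds that S is empty or contains an odd jump-length; without this the claim fails, e.g. for C(4,{2}), whose edges 13 and 24 cross in every YSL-order though Δ(G)=1, and it fails for every nonempty S of even jump-lengths. *)

(* Defs.v *)
From mathcomp Require Import all_boot all_order all_fingroup all_algebra.

Set Implicit Arguments.
Unset Strict Implicit.
Unset Printing Implicit Defensive.

Definition max_degree (T : finType) (e : rel T) : nat :=
  \max_(x : T) #|[set y | e x y]|.

Definition bipartite (T : finType) (e : rel T) : Prop :=
  exists A : {set T}, forall x y : T, e x y -> (x \in A) != (y \in A).

(* The vertices 1, ..., n and the positions p_1, ..., p_n on the circle are both
   indexed by 'I_n, whose elements are 0, ..., n - 1: the ordinal i stands for
   vertex i.+1, respectively for position p_(i.+1). *)
Definition label (n : nat) (i : 'I_n) : nat := i.+1.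

Definition jump_set (n : nat) (S : seq nat) : Prop :=
  {in S, forall s, 0 < s <= n./2}.

Definition circulant (n : nat) (S : seq nat) : rel 'I_n :=
  fun i j => has (fun s => (label j == label i + s %[mod n])
                        || (label i == label j + s %[mod n])) S.

(* [order q] is the vertex carried by position [q]. *)
Definition YSL_order (n : nat) (order : {perm 'I_n}) : Prop :=
  (forall q : 'I_n, odd (label q) -> order q = q) /\
  (exists m : int, forall q : 'I_n, ~~ odd (label q) ->
     (Posz (label (order q)) = 2 * m - Posz (label q) %[mod (Posz n)])%Z).

Definition strictly_between (a b c : nat) : bool := minn a b < c < maxn a b.

(* The chords {a, b} and {c, d} between numbered positions on a circle cross:
   exactly one of c, d lies on the arc from min a b to max a b. *)
Definition chords_cross (a b c d : nat) : bool :=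
  uniq [:: a; b; c; d] && (strictly_between a b c != strictly_between a b d).

(* [pos x] is the position of the vertex [x].  Edges are two-element sets, and
   the values of [color] on sets that are not edges are irrelevant. *)
Definition dispersable_wrt (T : finType) (e : rel T) (pos : T -> nat) : Prop :=
  exists color : {set T} -> nat,
    (forall x y : T, e x y -> color [set x; y] < max_degree e) /\
    (forall x y z w : T, e x y -> e z w ->
       [set x; y] != [set z; w] -> color [set x; y] = color [set z; w] ->
       [disjoint [set x; y] & [set z; w]] /\
       ~~ chords_cross (pos x) (pos y) (pos z) (pos w)).

(* Main.v *)
Require Import Defs.
From mathcomp Require Import all_boot all_order all_fingroup all_algebra.
From mathcomp Require Import zify.

Set Implicit Arguments.
Unset Strict Implicit.
Unset Printing Implicit Defensive.

(** Walking [t] jumps [s] and walking [s] jumps [t] lead to the same vertex, so in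
    a bipartite circulant all jumps have the same parity; as one of them is odd,
    each edge joins an odd vertex [a] to an even vertex [b].  In a YSL-order [a]
    sits at position [a] and [b] at position [2m - b], so the sum of the two
    positions is [2m - (b - a)] modulo [n]: edges with the same signed jump
    [b - a] are parallel chords, hence form a non-crossing matching.  There are
    as many signed jumps as neighbours of vertex 1. *)

Lemma eqn_modP (n a b : nat) :
  a = b %[mod n] <-> exists u v, a + u * n = b + v * n.
Proof.
split=> [eq_ab | [u [v eq_ab]]].
  exists (b %/ n), (a %/ n).
  by rewrite {1}(divn_eq a n) {2}(divn_eq b n) eq_ab; lia.
by rewrite -(modnMDl u a) -(modnMDl v b) addnC eq_ab addnC.
Qed.

(** Both sums lie below [2 * n], so they agree or differ by exactly [n]. Equal sums make the two
    index intervals concentric, hence nested. A difference of [n] puts both ends of one chord above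
    both ends of the other, since every index is below [n]. *)
Lemma parallel_chords_disjoint (n a b c d : nat) :
  a < n -> b < n -> c < n -> d < n -> a + b = c + d %[mod n] ->
  ~~ chords_cross a b c d.
Proof.
move=> lt_a lt_b lt_c lt_d /eqn_modP [u [v eq_sum]].
have [eq_uv | /eqP neq_uv] := eqVneq u v.
  by subst v; rewrite /chords_cross /strictly_between /= !inE; lia.
have : a + b >= c + d + n \/ c + d >= a + b + n by nia.
by rewrite /chords_cross /strictly_between /= !inE; lia.
Qed.

Lemma circulantP (n : nat) (S : seq nat) (x y : 'I_n) :
  reflect (exists2 s, s \in S & y = x + s %[mod n] \/ x = y + s %[mod n])
          (circulant S x y).
Proof.
have labelD (i j s : nat) : (i.+1 == j.+1 + s %[mod n]) = (i == j + s %[mod n]).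
  by rewrite -(addn1 i) -(addn1 j) addnAC eqn_modDr.
apply: (iffP hasP) => -[s Ss xy]; exists s => //; move: xy; rewrite /label !labelD.
  by case/orP=> /eqP; [left | right].
by case=> /eqP->; rewrite ?orbT.
Qed.

Lemma circulant_sym (n : nat) (S : seq nat) : symmetric (@circulant n S).
Proof. by move=> x y; apply: eq_has => s; rewrite orbC. Qed.

(** Adjacency depends only on the signed jump; [y - x] and [w - z] are compared additively because
    subtraction on [nat] truncates. *)
Lemma circulant_shift (n : nat) (S : seq nat) (x y z w : 'I_n) :
  y + z = w + x %[mod n] -> circulant S x y -> circulant S z w.
Proof.
move=> /eqn_modP [a [b ab]] /circulantP [s Ss xy]; apply/circulantP; exists s => //.
case: xy => /eqn_modP [c [d cd]]; [left | right]; apply/eqn_modP.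
  by exists (b + c), (a + d); lia.
by exists (a + c), (b + d); lia.
Qed.

Lemma bipartite_circulant_jump_parity (n : nat) (S : seq nat) (s t : nat) :
  0 < n -> bipartite (@circulant n S) -> s \in S -> t \in S -> odd s = odd t.
Proof.
case: n => // n _ [A bipA] Ss St.
(* Each jump switches sides of the bipartition, so after [j] jumps from [ord0] the side is decided
   by the parity of [j]. *)
have walk r j : r \in S ->
    (inord ((j * r) %% n.+1) \in A :> bool) = (ord0 \in A) (+) odd j :> bool.
  move=> Sr; elim: j => [|j IHj]; first by rewrite mul0n mod0n addbF -[ord0]inord_val.
  have: circulant S (inord ((j * r) %% n.+1)) (inord ((j.+1 * r) %% n.+1) : 'I_n.+1).
    apply/circulantP; exists r => //; left.
    by rewrite !inordK ?ltn_pmod // modnDml modn_mod mulSn addnC.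
  move/bipA; rewrite IHj /=.
  by case: (_ \in A); case: (_ \in A); case: (odd j).
by have := walk s t Ss; rewrite mulnC (walk t s St) => /addbI.
Qed.

Lemma bipartite_circulant_label_parity (n k : nat) (S : seq nat) (x y : 'I_n) :
  n = k.*2 -> bipartite (@circulant n S) -> (exists2 s, s \in S & odd s) ->
  circulant S x y -> odd (label x) = ~~ odd (label y).
Proof.
move=> def_n bip [t St odd_t] /circulantP [s Ss xy].
have odd_s : odd s.
  by rewrite (bipartite_circulant_jump_parity _ bip Ss St) // (leq_trans _ (ltn_ord x)).
(* Reduction modulo the even [n] keeps parity, so an odd jump flips it. *)
rewrite /label; case: xy => /eqn_modP [u [v]]; subst n; lia.
Qed.

Section YSL.

Variables (n : nat) (order : {perm 'I_n}).
Hypothesis hYSL : YSL_order order.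

Let pos (x : 'I_n) : 'I_n := (order^-1)%g x.

Lemma YSL_pos_odd x : odd (label x) -> pos x = x.
Proof. by move=> odd_x; apply: (@perm_inj _ order); rewrite permKV hYSL.1. Qed.

(** A single [m] serves all even vertices, so it cancels when two edges are compared. *)
Lemma YSL_pos_even : exists m : int, forall x, ~~ odd (label x) ->
  exists c : int, (Posz (label x) + Posz (label (pos x)) = m + c * Posz n)%R.
Proof.
case: hYSL => fix_odd [m posE]; exists (2 * m)%R => x even_x.
have even_q : ~~ odd (label (pos x)).
  apply: contra even_x => odd_q.
  by have := fix_odd _ odd_q; rewrite permKV => ->.
move/eqP: (posE _ even_q); rewrite permKV eqz_mod_dvd => /dvdzP [c Ec].
by exists c; lia.
Qed.

Lemma YSL_pos_sum x y z w :
  odd (label x) -> ~~ odd (label y) -> odd (label z) -> ~~ odd (label w) ->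
  y + z = w + x %[mod n] -> pos x + pos y = pos z + pos w %[mod n].
Proof.
move=> ox ey oz ew /eqn_modP [a [b ab]].
have [m posE] := YSL_pos_even.
have [c Ec] := posE _ ey; have [d Ed] := posE _ ew.
rewrite (YSL_pos_odd ox) (YSL_pos_odd oz) /label in Ec Ed *.
suff : (Posz (x + pos y) = Posz (z + pos w) %[mod Posz n])%Z.
  by rewrite !modz_nat => -[].
apply/eqP; rewrite eqz_mod_dvd; apply/dvdzP.
by exists (c - d + Posz a - Posz b)%R; lia.
Qed.

End YSL.

Theorem theorem1 (n k : nat) (S : seq nat) (order : {perm 'I_n})
    (hn : 3 <= n) (hnk : n = k.*2) (hS : jump_set n S)
    (hbip : bipartite (@circulant n S))
    (hodd : S = [::] \/ exists2 s, s \in S & odd s)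
    (hYSL : YSL_order order) :
  dispersable_wrt (@circulant n S) (fun v : 'I_n => (order^-1)%g v).
Proof.
case: hodd => [-> | hodd]; first by exists (fun=> 0); split.
have parity := bipartite_circulant_label_parity hnk hbip hodd.
have n_gt0 : 0 < n by apply: leq_trans hn.
pose pos x : 'I_n := (order^-1)%g x.
pose x0 := Ordinal n_gt0.
(* Summing over the set makes the value independent of the order of the endpoints. *)
pose slope (A : {set 'I_n}) := (\sum_(x in A) pos x) %% n.
have slope_edge x y : circulant S x y -> slope [set x; y] = (pos x + pos y) %% n.
  move=> e_xy; have neq_xy : x != y.
    by apply: contraTneq e_xy => ->; apply/negP=> /parity; case: (odd _).
  by rewrite /slope big_setU1 ?inE // big_set1.
(* The colors are the indices in this list, whose length is the degree of [x0], the vertex labelled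
   1. *)
pose slopes := [seq slope [set x0; y] | y in circulant S x0].
have slopesP x y : circulant S x y -> slope [set x; y] \in slopes.
  wlog odd_x : x y / odd (label x) => [wlog_x e_xy | e_xy].
    have [|even_x] := boolP (odd (label x)); first by move/wlog_x; apply.
    rewrite setUC; apply: wlog_x; last by rewrite circulant_sym.
    by have := parity _ _ e_xy; rewrite (negPf even_x); case: (odd _).
  (* Rotate the edge so that its odd end lands on [x0]: [y0] is [y - x] modulo [n]. *)
  pose y0 := Ordinal (ltn_pmod (y + (n - x)) n_gt0).
  have shift : y + x0 = y0 + x %[mod n].
    rewrite /= modnDml -addnA subnK ?modnDr ?addn0 //; exact: ltnW.
  have e_0 : circulant S x0 y0 by apply: circulant_shift e_xy.
  apply/imageP; exists y0 => //; rewrite !slope_edge //.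
  apply: (YSL_pos_sum hYSL) => //; first by rewrite -(parity _ _ e_xy).
  by rewrite -(parity _ _ e_0).
exists (fun A => index (slope A) slopes); split=> [x y e_xy | x y z w e_xy e_zw].
  have: size slopes <= max_degree (@circulant n S).
    rewrite size_image -cardsE /max_degree; exact: (leq_bigmax x0).
  by apply: leq_trans; rewrite index_mem slopesP.
move=> neq_edges /(congr1 (nth 0 slopes)); rewrite !nth_index ?slopesP //.
rewrite !slope_edge // -!/(pos _) => eq_slope; split; last first.
  exact: parallel_chords_disjoint eq_slope.
(* Edges of equal slope that share one endpoint share the other, hence coincide. *)
have pos_eq a b c : pos a + pos b = pos a + pos c %[mod n] -> b = c.
  move/eqP; rewrite eqn_modDl !modn_small // => /eqP /val_inj; exact: perm_inj.
rewrite -setI_eq0; apply: contraNT neq_edges => /set0Pn [v].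
rewrite !inE => /andP [/orP [] /eqP-> /orP [] /eqP Ev]; rewrite -{}Ev in eq_slope *.
- by rewrite (pos_eq _ _ _ eq_slope).
- by rewrite [in RHS]addnC in eq_slope; rewrite (pos_eq _ _ _ eq_slope) setUC.
- by rewrite addnC in eq_slope; rewrite (pos_eq _ _ _ eq_slope) setUC.
- by rewrite addnC [in RHS]addnC in eq_slope; rewrite (pos_eq _ _ _ eq_slope).
Qed.
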